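(* Let $\mathcal N=[n]$, $\mathcal M=[m]$, let $v_i:2^{\mathcal M}\to\mathbb R_{\ge 0}$ ($i\in\mathcal N$) be monotone submodular valuations, let $b_i>0$ be entitlements with $\sum_{i\in\mathcal N}b_i=1$, and let $(\beta_i)_{i\in\mathcal N}$ be positive reals. Run the greedy procedure (described in the context) on this input, and let $(A_1,\dots,A_n)$ be the bundles held by the agents at termination. If an agent $i\in\mathcal N$ satisfies $\beta_i\le\mathsf{APS}_i$, then $v_i(A_i)\ge\frac13\beta_i$ (irrespective of the other agents' values $\beta_k$).
   Context: Submodular: $v(S\cup\{g\})-v(S)\ge v(Q\cup\{g\})-v(Q)$ for all $S\subseteq Q\subseteq \mathcal M$, $g\in\mathcal M\setminus Q$. Marginals: $v(g\mid S)=v(S\cup\{g\})-v(S)$. Any price share: $\mathsf{APS}_i=\min_{p}\max_{S\subseteq\mathcal M:\ \sum_{j\in S}p_j\le b_i}v_i(S)$, the minimum over $p\in\mathbb R_{\ge0}^m$ with $\sum_j p_j=1$. Greedy procedure. Define $\hat v_i(S)=\min\{nb_i,\ \frac{nb_i}{\beta_i}v_i(S)\}$ for all $i\in\mathcal N$, $S\subseteq\mathcal M$. Initialize $A_i=\emptyset$ for all $i$, the set of unallocated goods $\mathcal M^r=\mathcal M$, and the set of active agents $\mathcal N^r=\mathcal N$. While $\mathcal M^r\ne\emptyset$ and $\mathcal N^r\neq\emptyset$: choose $(i^*,j^* )\in\arg\max_{i\in\mathcal N^r,\,j\in\mathcal M^r}\min\{\frac23nb_i,\ \hat v_i(j\mid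 A_i)\}$ (ties broken arbitrarily); set $A_{i^*}\leftarrow A_{i^*}\cup\{j^*\}$ and $\mathcal M^r\leftarrow\mathcal M^r\setminus\{j^*\}$; if now $\hat v_{i^*}(A_{i^*})\ge nb_{i^*}/3$, remove $i^*$ from $\mathcal N^r$. *)

(* Defs.v *)
From mathcomp Require Import all_boot all_order all_algebra.
From mathcomp Require Import classical_sets boolp reals.

Set Implicit Arguments.
Unset Strict Implicit.
Unset Printing Implicit Defensive.

Import Order.TTheory GRing.Theory Num.Theory.
Local Open Scope ring_scope.

Section Valuations.
Variables (R : realType) (m : nat).
Implicit Types (v : {set 'I_m} -> R) (p : 'I_m -> R).

Definition marginal v (g : 'I_m) (S : {set 'I_m}) : R := v (g |: S) - v S.

Definition monotone v : Prop :=
  forall S Q : {set 'I_m}, S \subset Q -> v S <= v Q.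

Definition submodular v : Prop :=
  forall (S Q : {set 'I_m}) (g : 'I_m),
    S \subset Q -> g \notin Q -> marginal v g Q <= marginal v g S.

Definition is_price p : Prop :=
  (forall j, 0 <= p j) /\ \sum_j p j = 1.

(* For 0 <= b the empty bundle is affordable, so the base value [v set0] of
   the iterated maximum is one of the values being compared. *)
Definition best_affordable v (b : R) p : R :=
  \big[Num.max/v finset.set0]_(S : {set 'I_m} | \sum_(j in S) p j <= b) v S.

(* The minimum over price vectors, written as an infimum; [APS_min] shows that
   it is attained as soon as there is at least one good.  Without goods there
   is no price vector and the value is [inf set0 = 0]. *)
Definition APS v (b : R) : R :=
  inf [set x : R | exists2 p, is_price p & x = best_affordable v b p]%classic.

Lemma best_affordable_max v (b : R) p : 0 <= b ->
  (exists S : {set 'I_m},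
     \sum_(j in S) p j <= b /\ best_affordable v b p = v S) /\
  (forall S : {set 'I_m},
     \sum_(j in S) p j <= b -> v S <= best_affordable v b p).
Proof.
move=> b0; split; last by move=> S pS; apply: le_bigmax_cond.
rewrite /best_affordable; elim/big_ind: _ => [|x y [S [pS ->]] [T [pT ->]]|S pS].
- by exists finset.set0; rewrite big_set0.
- by case: (leP (v S) (v T)) => _; [exists T | exists S].
- by exists S.
Qed.

Lemma APS_min v (b : R) : (0 < m)%N -> 0 <= b ->
  (exists2 p, is_price p & APS v b = best_affordable v b p) /\
  (forall p, is_price p -> APS v b <= best_affordable v b p).
Proof.
move=> m0 b0.
pose P (S : {set 'I_m}) :=
  `[< exists2 p, is_price p & best_affordable v b p = v S >].
have PS p : is_price p -> exists2 S, P S & best_affordable v b p = v S.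
  move=> hp; have [[S [_ eS]] _] := best_affordable_max v p b0.
  by exists S => //; apply/asboolP; exists p.
have [S0 PS0 _] : exists2 S, P S & best_affordable v b
    (fun j => (j == Ordinal m0)%:R) = v S.
  apply: PS; split=> [j|]; first exact: ler0n.
  by rewrite (bigD1 (Ordinal m0)) // eqxx big1 /= => [|j /negPf -> //]; rewrite addr0.
have [S /asboolP [p hp eS] minS] := @arg_minP _ _ _ S0 P v PS0.
have lbS : lbound
    [set x : R | exists2 q, is_price q & x = best_affordable v b q]%classic (v S).
  by move=> _ [q hq ->]; have [T PT ->] := PS q hq; apply: minS.
have eA : APS v b = v S.
  apply/eqP; rewrite eq_le; apply/andP; split.
    by apply: ge_inf; [exists (v S) | exists p].
  by apply: lb_le_inf => //; exists (v S); exists p.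
split; first by exists p; rewrite ?eS.
by move=> q hq; rewrite eA; apply: lbS; exists q.
Qed.

End Valuations.

Section Greedy.
Variables (R : realType) (n m : nat).
Variables (v : 'I_n -> {set 'I_m} -> R) (b beta : 'I_n -> R).

Definition vhat (i : 'I_n) (S : {set 'I_m}) : R :=
  Num.min (n%:R * b i) (n%:R * b i / beta i * v i S).

Record greedy_state := GreedyState {
  bundle : {ffun 'I_n -> {set 'I_m}};
  unallocated : {set 'I_m};
  active : {set 'I_n}
}.

Definition greedy_init : greedy_state :=
  GreedyState [ffun _ => finset.set0] finset.setT finset.setT.

Definition greedy_bid (s : greedy_state) (i : 'I_n) (j : 'I_m) : R :=
  Num.min (2 / 3 * (n%:R * b i)) (marginal (vhat i) j (bundle s i)).

Definition greedy_choice (s : greedy_state) (i : 'I_n) (j : 'I_m) : Prop :=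
  [/\ i \in active s, j \in unallocated s &
      forall i' j', i' \in active s -> j' \in unallocated s ->
        greedy_bid s i' j' <= greedy_bid s i j].

Definition greedy_update (s : greedy_state) (i : 'I_n) (j : 'I_m) :
    greedy_state :=
  let A := j |: bundle s i in
  GreedyState [ffun k => if k == i then A else bundle s k]
              (unallocated s :\ j)
              (if n%:R * b i / 3 <= vhat i A then active s :\ i else active s).

(* [greedy_run s t]: some execution of the loop started in [s], under some
   tie-breaking, terminates in [t]. *)
Inductive greedy_run : greedy_state -> greedy_state -> Prop :=
| GreedyStop s :
    unallocated s = finset.set0 \/ active s = finset.set0 -> greedy_run s s
| GreedyStep s i j t :
    greedy_choice s i j -> greedy_run (greedy_update s i j) t -> greedy_run s t.

End Greedy.

(* Main.v *)
(** Charge every good the bid at which it was allocated.  Winning bids of an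
    agent do not increase over time, so an agent who receives at least two goods
    pays less than a third of [n b_k] both before and at her last purchase; an
    agent who receives one good pays at most [2/3 n b_k] because of the cap.
    Hence the total payment is at most [2/3 n], strictly less if agent [i] stays
    below [n b_i / 3].  Using the charges (padded to total [2/3 n] and
    normalized) as APS prices yields a bundle worth at least [beta_i] to [i]
    with charge less than [2/3 n b_i].  But [i] was active all along, so by
    submodularity the charges of this bundle dominate the capped marginals to
    [A_i], whose sum is at least [2/3 n b_i]. *)
Require Import Defs.
From mathcomp Require Import all_boot all_order all_algebra.
From mathcomp Require Import classical_sets boolp reals.
From mathcomp Require Import finset ring lra.

Set Implicit Arguments.
Unset Strict Implicit.
Unset Printing Implicit Defensive.

Import Order.TTheory GRing.Theory Num.Theory.
Local Open Scope ring_scope.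

(** * Marginals of monotone submodular functions *)

Section SubmodularValuations.
Variables (R : realType) (m : nat) (w : {set 'I_m} -> R).
Hypotheses (w_mono : monotone w) (w_sub : submodular w).

Lemma marginal_ge0 g S : 0 <= marginal w g S.
Proof. by rewrite subr_ge0; apply/w_mono/subsetUr. Qed.

Lemma marginal_antitone g (S Q : {set 'I_m}) :
  S \subset Q -> marginal w g Q <= marginal w g S.
Proof.
move=> SQ; have [gQ|gQ] := boolP (g \in Q); last exact: w_sub.
rewrite {1}/marginal (setUidPr _) ?sub1set // subrr.
exact: marginal_ge0.
Qed.

(** The goods of [S] join [A] one at a time, and each marginal to the enlarged set is at most the
    marginal to [A]. *)
Lemma le_sum_marginal (A S : {set 'I_m}) :
  w (S :|: A) - w A <= \sum_(j in S) marginal w j A.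
Proof.
have [k] := ubnP #|S|; elim: k S => // k IH S ltSk.
have [->|[x xS]] := set_0Vmem S; first by rewrite set0U subrr big_set0.
have ltS'k : (#|S :\ x| < k)%N by rewrite (cardsD1 x) xS in ltSk.
rewrite (big_setD1 x xS) /=.
have -> : S :|: A = x |: (S :\ x :|: A) by rewrite setUA setD1K.
have := IH _ ltS'k.
have := marginal_antitone x (subsetUr (S :\ x) A).
rewrite {1}/marginal; lra.
Qed.

(** Either one good of [S] reaches the cap [K] on its own, or no cap binds and the plain marginals
    already sum to enough. *)
Lemma le_sum_capped_marginal (K : R) (A S : {set 'I_m}) :
    0 <= K -> K <= w S - w A ->
  K <= \sum_(j in S) Num.min K (marginal w j A).
Proof.
move=> K0 leK.
have min_ge0 j : 0 <= Num.min K (marginal w j A).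
  by rewrite le_min K0 marginal_ge0.
have [/exists_inP[j jS Kj]|/exists_inPn noj] :=
  boolP [exists j in S, K <= marginal w j A].
  rewrite (big_setD1 j jS) /= (min_idPl Kj) lerDl.
  by apply: sumr_ge0.
rewrite (eq_bigr (fun j => marginal w j A)) => [|j jS]; last first.
  by apply/min_idPr/ltW; rewrite ltNge noj.
apply: le_trans (le_sum_marginal A S); apply: le_trans leK _.
by rewrite lerD2r; apply/w_mono/subsetUl.
Qed.

End SubmodularValuations.

(** Truncation at [c] is concave and nondecreasing, so diminishing increments survive it; this gives
    submodularity of [vhat]. *)
Lemma min_increment_antitone (R : realDomainType) (c x y x' y' : R) :
    x <= y -> x <= x' -> y' - y <= x' - x ->
  Num.min c y' - Num.min c y <= Num.min c x' - Num.min c x.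
Proof.
move=> *.
by case: (leP c y'); case: (leP c y); case: (leP c x'); case: (leP c x); lra.
Qed.

(** * Scaled and capped valuations *)

Section CappedValuation.
Variables (R : realType) (n m : nat).
Variables (v : 'I_n -> {set 'I_m} -> R) (b beta : 'I_n -> R) (i : 'I_n).
Hypotheses (v_ge0 : forall S, 0 <= v i S) (v_monotone : monotone (v i)).
Hypotheses (v_submodular : submodular (v i)).
Hypotheses (b_gt0 : 0 < b i) (beta_gt0 : 0 < beta i).

Let n_gt0 : 0 < n%:R :> R.
Proof. by rewrite ltr0n; case: (i) => k; apply: leq_ltn_trans. Qed.

Lemma share_gt0 : 0 < n%:R * b i.
Proof. exact: mulr_gt0. Qed.

Let scale_gt0 : 0 < n%:R * b i / beta i.
Proof. exact: divr_gt0 share_gt0 beta_gt0. Qed.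

Lemma vhat_ge0 S : 0 <= vhat v b beta i S.
Proof. by rewrite le_min ltW ?share_gt0 //= mulr_ge0 // ltW. Qed.

Lemma vhat_monotone : monotone (vhat v b beta i).
Proof.
move=> S Q SQ; rewrite /vhat le_min ge_min lexx /= ge_min.
by rewrite ler_pM2l // v_monotone // orbT.
Qed.

Lemma vhat_submodular : submodular (vhat v b beta i).
Proof.
move=> S Q g SQ gQ; apply: min_increment_antitone; rewrite -?mulrBr ler_pM2l //.
- exact: v_monotone.
- exact/v_monotone/subsetUr.
- exact: v_submodular.
Qed.

Lemma vhat_saturated S : beta i <= v i S -> vhat v b beta i S = n%:R * b i.
Proof.
move=> leS; apply/min_idPl; rewrite -[leLHS](divfK (lt0r_neq0 beta_gt0)).
by rewrite ler_pM2l.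
Qed.

Lemma vhat_lt_third S :
  v i S < 1 / 3 * beta i -> vhat v b beta i S < n%:R * b i / 3.
Proof.
move=> ltS; rewrite gt_min; apply/orP; right.
have -> : n%:R * b i / 3 = n%:R * b i / beta i * (1 / 3 * beta i).
  by field; apply: lt0r_neq0.
by rewrite ltr_pM2l.
Qed.

End CappedValuation.

(** * Charges turned into any-price-share prices *)

Section AnyPriceShare.
Variables (R : realType) (m : nat) (w : {set 'I_m} -> R) (b : R).
Hypothesis b_gt0 : 0 < b.

Lemma APS_gt0_goods : 0 < APS w b -> (0 < m)%N.
Proof.
case: posnP => // m0; rewrite /APS.
suff -> : [set x | exists2 p, is_price p & x = best_affordable w b p]%classic
    = classical_sets.set0 by rewrite inf0 ltxx.
apply/seteqP; split=> // x [p [_ sum_p] _].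
have := oner_neq0 R; rewrite -sum_p big1 ?eqxx // => j.
by have := ltn_ord j; rewrite [X in (_ < X)%N]m0.
Qed.

(* Padding every charge equally up to the total [T] makes the price of each
   nonempty bundle exceed its charge strictly, even if all charges are [0]. *)
Lemma APS_affordable (q : 'I_m -> R) (T : R) :
    0 < APS w b -> (forall j, 0 <= q j) -> \sum_j q j < T ->
  exists2 S : {set 'I_m}, \sum_(j in S) q j < b * T & APS w b <= w S.
Proof.
move=> aps_gt0 q_ge0 q_lt; have m_gt0 := APS_gt0_goods aps_gt0.
have mR_gt0 : 0 < m%:R :> R by rewrite ltr0n.
have T_gt0 : 0 < T by apply: le_lt_trans q_lt; apply: sumr_ge0.
pose e := (T - \sum_j q j) / m%:R.
have e_gt0 : 0 < e by rewrite divr_gt0 // subr_gt0.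
have price_q : is_price (fun j => (q j + e) / T).
  split=> [j|]; first by rewrite divr_ge0 ?addr_ge0 // ltW.
  rewrite -mulr_suml big_split /= sumr_const card_ord -mulr_natr /e.
  by field; rewrite !lt0r_neq0.
have [_ /(_ _ price_q) le_best] := APS_min w m_gt0 (ltW b_gt0).
have [[S [affS eS]] _] :=
  best_affordable_max w (fun j => (q j + e) / T) (ltW b_gt0).
exists S; last by rewrite -eS.
(* The empty bundle gets no padding; its strict bound is just [0 < b * T]. *)
have [->|[j jS]] := set_0Vmem S; first by rewrite big_set0 mulr_gt0.
rewrite -mulr_suml ler_pdivrMr // in affS; apply: lt_le_trans affS.
apply: ltr_sum; last by move=> k _; rewrite ltrDl.
by apply/hasP; exists j; rewrite ?mem_index_enum.
Qed.

End AnyPriceShare.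

(** * The charging invariant along a greedy run *)

Section Greedy.
Variables (R : realType) (n m : nat).
Variables (v : 'I_n -> {set 'I_m} -> R) (b beta : 'I_n -> R).
Hypotheses (v_ge0 : forall i S, 0 <= v i S).
Hypotheses (v_monotone : forall i, monotone (v i)).
Hypotheses (v_submodular : forall i, submodular (v i)).
Hypotheses (b_gt0 : forall i, 0 < b i) (beta_gt0 : forall i, 0 < beta i).

Local Notation w := (vhat v b beta).
Local Notation c k := (n%:R * b k).
Local Notation bid := (greedy_bid v b beta).

(* [q j] is the bid at which the good [j] was allocated ([0] before that) and
   [pay k] is the total charge of the goods held by [k]. *)
Record charging (s : greedy_state n m) (q : 'I_m -> R) (pay : 'I_n -> R) :
    Prop := Charging {
  charge_ge0 : forall j, 0 <= q j;
  charge_unallocated : forall j, j \in unallocated s -> q j = 0;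
  charge_total : \sum_j q j = \sum_k pay k;
  pay_le : forall k, pay k <= 2 / 3 * c k;
  pay_active : forall k, k \in active s -> pay k <= w k (bundle s k);
  bid_active : forall k, k \in active s -> pay k = 0 \/
    w k (bundle s k) < c k / 3 /\
    forall j, j \in unallocated s -> bid s k j < c k / 3;
  bid_le_charge : forall k j, k \in active s -> j \notin unallocated s ->
    bid s k j <= q j;
  inactive_third : forall k, k \notin active s -> c k / 3 <= w k (bundle s k)
}.

Let w_mono k := vhat_monotone (@v_monotone k) (b_gt0 k) (beta_gt0 k).
Let w_sub k :=
  vhat_submodular (@v_monotone k) (@v_submodular k) (b_gt0 k) (beta_gt0 k).
Let w_ge0 k := vhat_ge0 (v_ge0 k) (b_gt0 k) (beta_gt0 k).
Let c_gt0 k : 0 < c k := share_gt0 (b_gt0 k).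

Lemma bid_ge0 s k j : 0 <= bid s k j.
Proof.
rewrite le_min marginal_ge0; last exact: w_mono.
by rewrite andbT mulr_ge0 ?(ltW (c_gt0 k)) //; lra.
Qed.

(** Bundles only grow, so by submodularity of [vhat] no bid rises, not even the buyer's. *)
Lemma bid_update s k j k' j' :
  bid (greedy_update v b beta s k j) k' j' <= bid s k' j'.
Proof.
rewrite le_min ge_min lexx /= ge_min; apply/orP; right.
apply: marginal_antitone; [exact: w_mono | exact: w_sub | rewrite /= ffunE].
by case: eqP => [->|//]; apply: subsetUr.
Qed.

Lemma charging_init :
  charging (greedy_init n m) (fun=> 0) (fun=> 0).
Proof.
split=> //= [|k|k _|k j _|k]; rewrite ?in_setT //.
- by rewrite !big1.
- by have := c_gt0 k; lra.
- by left.
Qed.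

Lemma charging_step s k j q pay :
    greedy_choice v b beta s k j -> charging s q pay ->
  charging (greedy_update v b beta s k j)
    (fun j' => if j' == j then bid s k j else q j')
    (fun k' => if k' == k then pay k + bid s k j else pay k').
Proof.
move=> [k_act j_un maxbid] ch; set s' := greedy_update _ _ _ s k j.
have act' k' : k' \in active s' -> k' \in active s.
  by rewrite /s' /=; case: ifP => _ //; rewrite in_setD1 => /andP[].
have bundle'k : bundle s' k = j |: bundle s k by rewrite /s' /= ffunE eqxx.
have bundle'N k' : k' != k -> bundle s' k' = bundle s k'.
  by move=> /negPf nk; rewrite /s' /= ffunE nk.
have act'k : k \in active s' -> w k (bundle s' k) < c k / 3.
  rewrite bundle'k /s' /=; case: ifP => [|/negbT]; last by rewrite -ltNge.
  by rewrite in_setD1 eqxx.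
have un' j' : j' \in unallocated s' -> j' != j /\ j' \in unallocated s.
  by rewrite in_setD1 => /andP.
have bid_marg : bid s k j <= marginal (w k) j (bundle s k).
  by rewrite ge_min lexx orbT.
have bid_cap : bid s k j <= 2 / 3 * c k by rewrite ge_min lexx.
split.
- by move=> j'; case: ifP => _; [exact: bid_ge0 | exact: charge_ge0 ch _].
- by move=> j' /un'[/negPf -> /(charge_unallocated ch)].
- have := charge_total ch.
  rewrite (bigD1 j) //= (charge_unallocated ch j_un) add0r.
  rewrite [in RHS](bigD1 k) //= => eq_tot.
  rewrite [LHS](bigD1 j) //= eqxx [RHS](bigD1 k) //= eqxx.
  rewrite (eq_bigr q) => [|j' /negPf -> //].
  rewrite [in RHS](eq_bigr pay) => [|k' /negPf -> //].
  by rewrite eq_tot addrA [bid _ _ _ + _]addrC.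
- move=> k'; case: eqP => [->|_]; last exact: pay_le ch _.
  (* With nothing paid so far the cap in the bid suffices; otherwise the old payment and the new bid
     are each below [c k / 3]. *)
  have [->|[w_lt bid_lt]] := bid_active ch k_act; first by rewrite add0r.
  by have := pay_active ch k_act; have := bid_lt _ j_un; lra.
- move=> k' /act' k'_act; case: eqP => [->|/eqP nk]; last first.
    by rewrite bundle'N //; apply: pay_active ch _ k'_act.
  rewrite bundle'k; have := pay_active ch k_act.
  by move: bid_marg; rewrite /marginal; lra.
- move=> k' k'_act'; case: eqP => [ek|/eqP nk]; last first.
    rewrite bundle'N //; have [->|[w_lt bid_lt]] := bid_active ch (act' _ k'_act').
      by left.
    right; split=> // j' /un'[_ /bid_lt]; apply: le_lt_trans; exact: bid_update.
  subst k'; right; split; first exact: act'k.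
  (* By maximality every remaining bid of [k] is at most the winning one, hence at most the value of
     the new bundle, which is below [c k / 3] since [k] stays active. *)
  move=> j' /un'[_ j'_un]; apply: le_lt_trans (bid_update _ _ _ _ _) _.
  apply: le_lt_trans (maxbid _ _ k_act j'_un) _; apply: le_lt_trans bid_marg _.
  have := act'k k'_act'; have := w_ge0 k (bundle s k).
  by rewrite bundle'k /marginal; lra.
- move=> k' j' /act' k'_act j'_un; apply: le_trans (bid_update _ _ _ _ _) _.
  (* For the good just sold this is the maximality of the choice; for goods sold earlier the old
     bound persists. *)
  case: eqP => [->|/eqP nj]; first exact: maxbid.
  by apply: bid_le_charge ch _ _ k'_act _; move: j'_un; rewrite in_setD1 nj.
- move=> k'; have [->|nk] := eqVneq k' k.
    rewrite bundle'k /s' /=; by case: ifP => // _; rewrite k_act.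
  rewrite bundle'N // => k'_in; apply: inactive_third ch _ _.
  by move: k'_in; rewrite /s' /=; case: ifP => // _; rewrite in_setD1 nk.
Qed.

Lemma charging_run s t q pay :
    greedy_run v b beta s t -> charging s q pay ->
  (unallocated t = set0 \/ active t = set0) /\
  exists q' pay', charging t q' pay'.
Proof.
move=> run; elim: run q pay => {s t} [s stop|s k j t choice _ IH] q pay ch.
  by split=> //; exists q, pay.
exact: IH (charging_step choice ch).
Qed.

End Greedy.

Theorem theorem5p1 (R : realType) (n m : nat)
    (v : 'I_n -> {set 'I_m} -> R) (b beta : 'I_n -> R)
    (v_ge0 : forall i S, 0 <= v i S)
    (v_monotone : forall i, monotone (v i))
    (v_submodular : forall i, submodular (v i))
    (b_gt0 : forall i, 0 < b i)
    (b_sum1 : \sum_i b i = 1)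
    (beta_gt0 : forall i, 0 < beta i)
    (t : greedy_state n m)
    (t_run : greedy_run v b beta (greedy_init n m) t)
    (i : 'I_n)
    (beta_le_APS : beta i <= APS (v i) (b i)) :
  1 / 3 * beta i <= v i (bundle t i).
Proof.
have c_gt0 := share_gt0 (b_gt0 i).
rewrite leNgt; apply/negP => /(vhat_lt_third (b_gt0 i) (beta_gt0 i)) w_lt.
have aps_gt0 : 0 < APS (v i) (b i) by apply: lt_le_trans beta_le_APS.
have [stop [q [pay ch]]] := charging_run v_ge0 v_monotone v_submodular b_gt0
  beta_gt0 t_run (charging_init v_ge0 b_gt0 beta_gt0).
(* An agent below the threshold is still active, so the run can only have stopped for lack of
   goods. *)
have i_act : i \in active t.
  by apply/negPn/negP => /(inactive_third ch); rewrite leNgt w_lt.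
have un0 : unallocated t = set0.
  by case: stop => // act0; rewrite act0 inE in i_act.
have total_lt : \sum_j q j < 2 / 3 * n%:R.
  rewrite (charge_total ch).
  have -> : 2 / 3 * n%:R = \sum_k 2 / 3 * (n%:R * b k) :> R.
    by rewrite -!mulr_sumr b_sum1 mulr1.
  rewrite (bigD1 i) //= [ltRHS](bigD1 i) //=; apply: ltr_leD.
    by have := pay_active ch i_act; lra.
  by apply: ler_sum => k _; apply: pay_le ch k.
have [S q_lt le_S] := APS_affordable (b_gt0 i) aps_gt0 (charge_ge0 ch) total_lt.
have wS : vhat v b beta i S = n%:R * b i.
  by apply: vhat_saturated => //; apply: le_trans le_S.
(* [S] has the full capped value and the bundle of [i] less than a third of it; the gap is at least
   two thirds, which is exactly the cap in the bid. *)
have : 2 / 3 * (n%:R * b i) <= \sum_(j in S) greedy_bid v b beta t i j.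
  apply: le_sum_capped_marginal; rewrite ?wS; try lra.
  - exact: vhat_monotone.
  - exact: vhat_submodular.
(* Every good is allocated, so its charge dominates the final bid of [i], and [S] is charged too
   little. *)
rewrite leNgt => /negP; apply.
rewrite mulrA [ltRHS]mulrC; apply: le_lt_trans q_lt.
by apply: ler_sum => j _; apply: bid_le_charge ch _ _ i_act _; rewrite un0 inE.
Qed.
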